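(* Let $p$ be a strongly admissible premonic pattern, and let $\Lambda$ be a numerical semigroup admitting $p$. The following conditions are equivalent: (1) $\Lambda=\overline{\Lambda}\cup\{\mathrm{F}(\overline{\Lambda})\}$ for some numerical semigroup $\overline{\Lambda}$ admitting $p$; (2) the minimal $p$-system of generators of $\Lambda$ contains at least one element greater than $\mathrm{F}(\Lambda)$.
   Context: $\mathbb{N}$ denotes the set of nonnegative integers. A numerical semigroup is a subset of $\mathbb{N}$ that contains $0$, is closed under addition and has finite complement in $\mathbb{N}$. The Frobenius number $\mathrm{F}(\Lambda)$ of a numerical semigroup $\Lambda$ is $\max(\mathbb{N}\setminus\Lambda)$ if $\Lambda\ne\mathbb{N}$, and $\mathrm{F}(\mathbb{N})=-1$. A pattern of length $n$ is a linear homogeneous polynomial $p=\sum_{i=1}^n a_ix_i$ with all $a_i$ non-zero integers (for $n=0$ the unique pattern is $p=0$). A numerical semigroup $\Lambda$ admits $p$ if $p(s_1,\dots,s_n)\in\Lambda$ for all $s_1\geq s_2\geq\dots\geq s_n$ in $\Lambda$; $\mathcal{S}(p)$ is the set of all numerical semigroups admitting $p$. The pattern $p$ is admissible if $\mathcal{S}(p)\neq\emptyset$, equivalently if $\sum_{i=1}^{n'}a_i\ge 0$ for all $1\le n'\le n$. Set $p'=p-x_1$ if $a_1>1$ and $p'=p(0,x_1,x_2,\dots,x_{n-1})$ otherwise. The pattern $p$ is strongly admissible if both $p$ and $p'$ are admissible. The pattern $p$ is premonic if $\sum_{i=1}^{n'}a_i=1$ for some $1\le n'\leq n$. For an admissible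 pattern $p$, the $p$-closure of a numerical semigroup $\Lambda$ is the intersection of all $\Gamma\in\mathcal{S}(p)$ with $\Lambda\subseteq\Gamma$. For $A\subseteq\mathbb{N}$, $\langle A\rangle$ is the submonoid of $(\mathbb{N},+)$ generated by $A$. For $\Lambda\in\mathcal{S}(p)$, a set $A\subseteq\mathbb{N}$ is a $p$-system of generators of $\Lambda$ if $\langle A\rangle$ is a numerical semigroup whose $p$-closure is equal to $\Lambda$. It is minimal if it is minimal with respect to set inclusion among the $p$-systems of generators of $\Lambda$; when $p$ is strongly admissible and premonic, $\Lambda$ has a unique minimal $p$-system of generators. *)

(* Defs.v *)
From HB Require Import structures.
From mathcomp Require Import all_boot all_order all_algebra.
From mathcomp Require Import boolp classical_sets functions cardinality.

Set Implicit Arguments.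
Unset Strict Implicit.
Unset Printing Implicit Defensive.

Import Order.TTheory GRing.Theory Num.Theory.

Local Open Scope classical_set_scope.
Local Open Scope ring_scope.

Definition submonoid (M : set nat) : Prop :=
  M 0%N /\ forall x y, M x -> M y -> M (x + y)%N.

Definition numerical_semigroup (L : set nat) : Prop :=
  submonoid L /\ finite_set (~` L).

(* The set of maxima of the complement of L is empty when L = setT, in which
   case [xget] returns its default value -1; otherwise, for a numerical
   semigroup L, it is a singleton. *)
Definition frobenius (L : set nat) : int :=
  xget (-1) (Posz @` [set n | ~ L n /\ forall m, ~ L m -> (m <= n)%N]).

(* The pattern a_1 x_1 + ... + a_n x_n is encoded by the sequence
   [:: a_1; ...; a_n] of its coefficients; its length n is the size. *)
Definition is_pattern (p : seq int) : Prop := 0 \notin p.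

Definition pattern_eval (p : seq int) (s : (size p).-tuple nat) : int :=
  \sum_(i < size p) p`_i * (tnth s i)%:Z.

(* The value of p is an integer, hence the embedding of L into int. *)
Definition admits (p : seq int) (L : set nat) : Prop :=
  forall s : (size p).-tuple nat, sorted geq s ->
    (forall i, L (tnth s i)) -> (Posz @` L) (pattern_eval s).

Definition semigroups_admitting (p : seq int) : set (set nat) :=
  [set L | numerical_semigroup L /\ admits p L].

Definition admissible (p : seq int) : Prop := semigroups_admitting p !=set0.

(* The pattern p': p(0, x_1, ..., x_(n-1)) has coefficients a_2, ..., a_n.
   By convention p' = 0 for the pattern p = 0 of length 0. *)
Definition derived_pattern (p : seq int) : seq int :=
  if p is a :: q then if 1 < a then (a - 1) :: q else q else [::].

Definition strongly_admissible (p : seq int) : Prop :=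
  admissible p /\ admissible (derived_pattern p).

Definition premonic (p : seq int) : Prop :=
  exists k, (1 <= k <= size p)%N /\ \sum_(i < k) p`_i = 1.

Definition pattern_closure (p : seq int) (L : set nat) : set nat :=
  smallest (semigroups_admitting p) L.

Definition generated (A : set nat) : set nat := smallest submonoid A.

Definition pattern_generators (p : seq int) (L A : set nat) : Prop :=
  numerical_semigroup (generated A) /\ pattern_closure p (generated A) = L.

Definition minimal_pattern_generators (p : seq int) (L A : set nat) : Prop :=
  pattern_generators p L A /\
  forall B, pattern_generators p L B -> B `<=` A -> B = A.

(* Definite description: for p strongly admissible and premonic and L in
   [semigroups_admitting p], there is exactly one such set, and the default
   value set0 is not used. *)
Definition min_generators (p : seq int) (L : set nat) : set nat :=
  xget set0 [set A | minimal_pattern_generators p L A].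

(* Main.v *)
Require Import Defs.
From HB Require Import structures.
From mathcomp Require Import all_boot all_order all_algebra.
From mathcomp Require Import boolp classical_sets functions cardinality.
From mathcomp Require Import zify.

Set Implicit Arguments.
Unset Strict Implicit.
Unset Printing Implicit Defensive.

Import Order.TTheory GRing.Theory Num.Theory.

Local Open Scope classical_set_scope.
Local Open Scope ring_scope.

(** Strong admissibility gives [p(s_1, ..., s_n) >= s_1]: an element [a] of
    [L] obtained from other elements of [L] by a sum or by [p] is obtained
    from elements below [a].  Let [A] be a minimal [p]-system of generators of
    [L], let [a] be in [A], and let [G] be the smallest submonoid closed under
    [p] that contains [A \ {a}].  Adding to [G] the elements of [L] that are
    at least [a] yields a semigroup admitting [p], so [G] contains all the
    elements of [L] below [a].  If [a] were in [G] then [G] would be [L] and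
    [A \ {a}] would have gcd 1, because the multiples of the gcd are closed
    under [p]; it would be a smaller [p]-system of generators.  Hence [a] is
    not in [G], and [L \ {a}] is a semigroup admitting [p].  Conversely every
    [p]-system of generators contains each [a] such that [L \ {a}] is a
    semigroup admitting [p].  For [a > F(L)] one has [F(L \ {a}) = a]. *)

(** * Cofinite sets and the Frobenius number *)

Lemma finite_setC_nat (M : set nat) (n : nat) :
  (forall m, (n <= m)%N -> M m) -> finite_set (~` M).
Proof.
move=> nM; apply: (sub_finite_set _ (finite_II n)) => m /= Mm.
by rewrite ltnNge; apply/negP => /nM.
Qed.

Lemma finite_setC_natP (M : set nat) :
  finite_set (~` M) -> exists n, forall m, (n <= m)%N -> M m.
Proof.
move=> /finite_seqP[s sE]; exists (\max_(i <- s) i).+1 => m lt_m.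
apply: contrapT => Mm.
have : (~` M) m by [].
rewrite sE /= => ms.
by have := @leq_bigmax_seq _ s xpredT id m ms isT; rewrite leqNgt lt_m.
Qed.

Lemma frobeniusP (L : set nat) (n : nat) :
  frobenius L = n%:Z <-> ~ L n /\ forall m, (n < m)%N -> L m.
Proof.
rewrite /frobenius; split.
  case: xgetP => [x _ [m [Lm mL] <-] [<-]|_ //]; split=> // k lt_mk.
  by apply: contrapT => /mL; rewrite leqNgt lt_mk.
move=> [Ln nL].
have nP : [set k | ~ L k /\ forall m, ~ L m -> (m <= k)%N] n.
  by split=> // m Lm; rewrite leqNgt; apply/negP => /nL.
case: xgetP => [x _ [m [Lm mL] <-]|/(_ n%:Z) []]; last by exists n.
by congr Posz; apply/eqP; rewrite eqn_leq mL // andbT; case: nP => _; apply.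
Qed.

Lemma frobenius_lt (L : set nat) (n : nat) :
  finite_set (~` L) -> frobenius L < n%:Z -> forall m, (n <= m)%N -> L m.
Proof.
move=> /finite_setC_natP exN + m le_nm; rewrite ltNge => /negP FL.
apply: contrapT => Lm; apply: FL.
have exN' : exists N, `[< forall k, (N <= k)%N -> L k >].
  by have [N NL] := exN; exists N; apply/asboolP.
(* The least number from which on everything lies in [L] is 0, contradicting [Lm], or a successor
   [N.+1], and then [N] is the Frobenius number. *)
case: (ex_minnP exN') => -[|N] /asboolP NL Nmin; first by case: Lm; exact: NL.
have -> : frobenius L = N%:Z.
  apply/frobeniusP; split=> // LN.
  suff /Nmin : `[< forall k, (N <= k)%N -> L k >] by rewrite ltnn.
  by apply/asboolP => k; rewrite leq_eqVlt => /predU1P[<-//|/NL].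
rewrite lez_nat; apply: (leq_trans le_nm).
by rewrite -ltnS ltnNge; apply/negP => /NL.
Qed.

(** * Submonoids of the natural numbers *)

Lemma submonoid_mul (M : set nat) (k x : nat) :
  submonoid M -> M x -> M (k * x)%N.
Proof.
by move=> [M0 MD] Mx; elim: k => [//|k IHk]; rewrite mulSn; apply: MD.
Qed.

(* The least positive difference [g] of two elements of [M] divides [M], so
   that [M] contains some [y] and [y + 1]; every [n >= y ^ 2] is then a
   combination of these two. *)
Lemma submonoid_gcd1_cofinite (M : set nat) : submonoid M ->
  (forall d : nat, (forall x, M x -> d %| x)%N -> d = 1%N) ->
  finite_set (~` M).
Proof.
move=> Msub gcdM; have [M0 MD] := Msub.
pose G g := `[< (0 < g)%N /\ exists2 y, M y & M (y + g)%N >].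
have exG : exists g, G g.
  (* Without such a difference [M] is reduced to 0, which 2 divides. *)
  apply: contrapT => noG; suff : 2%N = 1%N by [].
  apply: gcdM => -[//|x] Mx; case: noG; exists x.+1.
  by apply/asboolP; split=> //; exists 0%N.
case: (ex_minnP exG) => g /asboolP [g_gt0 [y My Myg]] gmin.
have g1 : g = 1%N.
  apply: gcdM => z Mz; rewrite /dvdn; apply/negPn/negP => r0.
  suff /gmin : G (z %% g)%N by rewrite leqNgt ltn_mod g_gt0.
  apply/asboolP; split; first by rewrite lt0n.
  (* The elements [(z %/ g) * (y + g)] and [(z %/ g) * y + z] of [M] differ by the remainder of [z],
     which is less than [g]. *)
  exists ((z %/ g) * (y + g))%N; first exact: submonoid_mul.
  have -> : ((z %/ g) * (y + g) + z %% g = (z %/ g) * y + z)%N.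
    by rewrite {4}(divn_eq z g) mulnDr addnA.
  by apply: MD => //; apply: submonoid_mul.
rewrite {}g1 in Myg; apply: (@finite_setC_nat _ (y * y)%N) => n le_yn.
have [y0|y_gt0] := posnP y.
  by rewrite -(muln1 n); apply: submonoid_mul => //; rewrite y0 in Myg.
have le_yq : (y <= n %/ y)%N by rewrite leq_divRL.
have lt_ry : (n %% y < y)%N by rewrite ltn_mod.
have -> : n = ((n %/ y - n %% y) * y + (n %% y) * (y + 1))%N.
  by rewrite {1}(divn_eq n y); nia.
by apply: MD; apply: submonoid_mul.
Qed.

Lemma submonoid_generated (A : set nat) : submonoid (generated A).
Proof.
split=> [M [[M0 _] _] //|x y Ax Ay M AM].
by case: (AM) => -[_ MD] _; apply: MD; [apply: Ax|apply: Ay].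
Qed.

Lemma sub_generated (A : set nat) : A `<=` generated A.
Proof. exact: sub_gen_smallest. Qed.

Lemma generated_sub (A M : set nat) :
  submonoid M -> A `<=` M -> generated A `<=` M.
Proof. exact: smallest_sub. Qed.

(** If [L] contains all numbers from [N] on, its elements below [2 * N.+1] suffice: a larger [x] is
    the sum of [N.+1] and [x - N.+1], both in [L] and, since [N.+1] is positive, both less than
    [x]. *)
Lemma numerical_semigroup_fg (L : set nat) : numerical_semigroup L ->
  exists s : seq nat, generated [set` s] = L.
Proof.
move=> [Lsub /finite_setC_natP [N NL]].
exists [seq x <- iota 0 (N.+1 + N.+1) | `[< L x >]].
set s := [seq _ <- _ | _]; apply/seteqP; split.
  by apply: generated_sub => // x /=; rewrite mem_filter => /andP[/asboolP].
move=> x; elim/ltn_ind: x => x IHx Lx.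
have [lt_x|le_x] := ltnP x (N.+1 + N.+1).
  apply: sub_generated => /=; rewrite mem_filter mem_iota /= lt_x andbT.
  exact/asboolP.
have -> : x = (N.+1 + (x - N.+1))%N by lia.
apply: (submonoid_generated _).2; last by apply: IHx; [|apply: NL]; lia.
by apply: IHx; [|apply: NL]; lia.
Qed.

(** * Values of patterns *)

(* Values of [p] at nonincreasing sequences [nat -> nat] instead of tuples, so
   that the arguments of [p] and of its tail are of the same type. *)
Definition pattern_value (p : seq int) (f : nat -> nat) : int :=
  \sum_(i < size p) p`_i * (f i)%:Z.

Definition nonincreasing (f : nat -> nat) : Prop :=
  forall i j, (i <= j)%N -> (f j <= f i)%N.

Lemma pattern_value_cons (a : int) (q : seq int) (f : nat -> nat) :
  pattern_value (a :: q) f = a * (f 0)%:Z + pattern_value q (f \o succn).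
Proof. by rewrite /pattern_value big_ord_recl. Qed.

Lemma pattern_value_scale (p : seq int) (c : nat) (f : nat -> nat) :
  pattern_value p (fun i => c * f i)%N = c%:Z * pattern_value p f.
Proof.
rewrite /pattern_value mulr_sumr; apply: eq_bigr => i _.
by rewrite PoszM mulrCA.
Qed.

Lemma admitsP (p : seq int) (L : set nat) : L 0%N ->
  admits p L <-> forall f, nonincreasing f -> (forall i, L (f i)) ->
    exists2 x, L x & x%:Z = pattern_value p f.
Proof.
move=> L0; split=> [Lp f f_ni Lf|Lp s s_sorted Ls].
  have := Lp [tuple f i | i < size p].
  have -> : pattern_eval [tuple f i | i < size p] = pattern_value p f.
    by apply: eq_bigr => i _; rewrite tnth_mktuple.
  apply; last by move=> i; rewrite tnth_mktuple.
  have -> : tval [tuple f i | i < size p] = map f (iota 0 (size p)).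
    by rewrite -val_enum_ord -map_comp.
  apply: (homo_sorted (e := leq)); last exact: iota_sorted.
  by move=> i j; apply: f_ni.
have /Lp [] : nonincreasing (fun i => nth 0%N s i).
- move=> i j le_ij; have [lt_j|le_j] := ltnP j (size s); last first.
    by rewrite nth_default.
  have geq_trans : transitive geq.
    by move=> y x z /= yx zy; apply: leq_trans zy yx.
  apply: (sorted_leq_nth geq_trans (leqnn : reflexive geq) 0%N s_sorted) => //.
  by rewrite inE (leq_ltn_trans le_ij).
- move=> i; have [lt_i|le_i] := ltnP i (size s); last by rewrite nth_default.
  have lt_ip : (i < size p)%N by rewrite -(size_tuple s).
  by have := Ls (Ordinal lt_ip); rewrite (tnth_nth 0%N).
move=> x Lx xE; exists x => //; rewrite xE.
by apply: eq_bigr => i _; rewrite (tnth_nth 0%N).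
Qed.

(* Multiplying the arguments by a large constant moves them into a semigroup
   admitting [p]. *)
Lemma admissible_ge0 (p : seq int) (f : nat -> nat) :
  admissible p -> nonincreasing f -> 0 <= pattern_value p f.
Proof.
move=> [L [[[L0 LD] /finite_setC_natP [N NL]] /(admitsP _ L0) Lp]] f_ni.
have [||x _] := Lp (fun i => N.+1 * f i)%N.
- by move=> i j /f_ni; rewrite leq_pmul2l.
- move=> i; have [->|fi_gt0] := posnP (f i); first by rewrite muln0.
  by apply: NL; rewrite (leq_trans (leqnSn N)) // leq_pmulr.
rewrite pattern_value_scale => xE.
by rewrite -(@pmulr_rge0 _ N.+1%:Z) // -xE.
Qed.

(** Subtracting [x_1] from [p] leaves [p'] at the same arguments if [a_1 > 1], and [p'] at the
    shifted arguments if [a_1 = 1]; both are nonnegative. *)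
Lemma strongly_admissible_ge (p : seq int) (f : nat -> nat) :
  is_pattern p -> strongly_admissible p -> (0 < size p)%N ->
  nonincreasing f -> (f 0)%:Z <= pattern_value p f.
Proof.
case: p => // a q; rewrite /is_pattern inE negb_or eq_sym => /andP[a0 _].
move=> [adm adm'] _ f_ni; rewrite pattern_value_cons.
have a_ge0 : 0 <= a.
  (* At the arguments 1, 0, 0, ... the pattern takes the value [a]. *)
  have := @admissible_ge0 _ (fun i => (i == 0)%N : nat) adm.
  rewrite pattern_value_cons /= mulr1 /pattern_value big1 => [|i _].
    by rewrite addr0; apply=> -[|i] [|j].
  by rewrite mulr0.
move: adm'; rewrite /=; case: ltP => [a_gt1|a_le1] adm'.
  have := admissible_ge0 adm' f_ni.
  by rewrite pattern_value_cons mulrBl mul1r; lia.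
have -> : a = 1 by lia.
rewrite mul1r lerDl; apply: admissible_ge0 => // i j le_ij.
exact: f_ni.
Qed.

(** * Submonoids closed under the pattern *)

(** Cofiniteness is not imposed, so that the hull of [A] without [a] can be studied before its gcd
    is known to be 1. *)
Definition pattern_hull (p : seq int) (B : set nat) : set nat :=
  smallest [set M | submonoid M /\ admits p M] B.

Lemma submonoid_hull (p : seq int) (B : set nat) : submonoid (pattern_hull p B).
Proof.
split=> [M [[[M0 _] _] _] //|x y Bx By M BM].
by case: (BM) => -[[_ MD] _] _; apply: MD; [apply: Bx|apply: By].
Qed.

Lemma sub_hull (p : seq int) (B : set nat) : B `<=` pattern_hull p B.
Proof. exact: sub_gen_smallest. Qed.

Lemma hull_sub (p : seq int) (B M : set nat) :
  submonoid M -> admits p M -> B `<=` M -> pattern_hull p B `<=` M.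
Proof. by move=> Msub Mp; apply: smallest_sub. Qed.

Lemma admits_hull (p : seq int) (B : set nat) :
  admissible p -> admits p (pattern_hull p B).
Proof.
move=> adm; have [H0 _] := submonoid_hull p B.
apply/(admitsP _ H0) => f f_ni Hf.
have v_ge0 := admissible_ge0 adm f_ni.
exists `|pattern_value p f|%N; last by rewrite gez0_abs.
move=> M [[Msub Mp] BM].
have [i|x Mx <- //] := (admitsP p Msub.1).1 Mp f f_ni.
exact: (hull_sub Msub Mp BM).
Qed.

(** By homogeneity, [p] at multiples of [d] is [d] times its value at the quotients. *)
Lemma hull_dvdn (p : seq int) (B : set nat) (d : nat) : admissible p ->
  (forall x, B x -> d %| x)%N -> forall x, pattern_hull p B x -> (d %| x)%N.
Proof.
move=> adm; apply: hull_sub.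
  by split=> [|x y]; [exact: dvdn0 | exact: dvdn_add].
apply/admitsP => [|f f_ni df]; first exact: dvdn0.
have g_ni : nonincreasing (fun i => f i %/ d)%N.
  by move=> i j /f_ni; apply: leq_div2r.
exists (d * `|pattern_value p (fun i => f i %/ d)|)%N; first exact: dvdn_mulr.
rewrite PoszM gez0_abs ?admissible_ge0 // -pattern_value_scale.
by apply: eq_bigr => i _; rewrite mulnC divnK ?df.
Qed.

Lemma pattern_closure_hull (p : seq int) (B L : set nat) :
  numerical_semigroup L -> admits p L -> pattern_hull p B = L ->
  pattern_closure p (generated B) = L.
Proof.
move=> LP Lp BL; apply/seteqP; split.
  apply: smallest_sub => //; apply: generated_sub; first exact: LP.1.
  by rewrite -BL; apply: sub_hull.
move=> x Lx M [[MP Mp] BM]; suff : pattern_hull p B `<=` M by rewrite BL; apply.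
by apply: hull_sub (MP.1) Mp _; apply: subset_trans BM; apply: sub_generated.
Qed.

(** * Systems of generators with respect to the pattern *)

Lemma pattern_generators_sub (p : seq int) (L A M : set nat) :
  pattern_generators p L A -> numerical_semigroup M -> admits p M ->
  A `<=` M -> L `<=` M.
Proof.
move=> [_ <-] MP Mp AM; apply: smallest_sub => //.
by apply: generated_sub => //; exact: MP.1.
Qed.

Lemma pattern_generatorsW (p : seq int) (L A : set nat) :
  pattern_generators p L A -> A `<=` L.
Proof.
move=> [_ <-]; apply: subset_trans (@sub_generated A) _.
exact: sub_gen_smallest.
Qed.

(** A common divisor of [B] divides the whole hull [L], which contains two consecutive numbers;
    hence it is 1. *)
Lemma pattern_generatorsP (p : seq int) (L B : set nat) :
  admissible p -> numerical_semigroup L -> admits p L ->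
  pattern_hull p B = L -> pattern_generators p L B.
Proof.
move=> adm LP Lp BL; split; last exact: pattern_closure_hull.
split; first exact: submonoid_generated.
apply: submonoid_gcd1_cofinite => [|d dB]; first exact: submonoid_generated.
have dL x : L x -> (d %| x)%N.
  by rewrite -BL; apply: hull_dvdn => // y /sub_generated /dB.
have [N NL] := finite_setC_natP LP.2.
have := dL _ (NL _ (leqnSn N)).
by rewrite -addn1 (dvdn_addr _ (dL _ (NL _ (leqnn N)))) dvdn1 => /eqP.
Qed.

(** Finite systems exist, since [L] is finitely generated as a monoid; one of least size is minimal
    for inclusion. *)
Lemma minimal_pattern_generators_ex (p : seq int) (L : set nat) :
  numerical_semigroup L -> admits p L ->
  exists A, minimal_pattern_generators p L A.
Proof.
move=> LP Lp.
pose P n := `[< exists2 s : seq nat,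
  size s = n & pattern_generators p L [set` s] >].
have exP : exists n, P n.
  have [s sL] := numerical_semigroup_fg LP.
  exists (size s); apply/asboolP; exists s => //; split; rewrite sL //.
  by apply/seteqP; split; [exact: smallest_sub | exact: sub_gen_smallest].
case: (ex_minnP exP) => n /asboolP [s <- sP] smin.
exists [set` s]; split=> // B BP Bs.
set t := [seq x <- s | `[< B x >]].
have tB : [set` t] = B.
  apply/seteqP; split=> x /=; rewrite mem_filter; first by case/andP=> /asboolP.
  by move=> Bx; apply/andP; split; [exact/asboolP | exact: Bs].
have /smin : P (size t) by apply/asboolP; exists t; rewrite ?tB.
rewrite size_filter => le_st.
have : all (fun x => `[< B x >]) s.
  by rewrite all_count eqn_leq count_size.
move=> /allP sB; apply/seteqP; split=> // x /= /sB /asboolP; exact.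
Qed.

(** * Removing one element from a semigroup *)

Lemma generator_removable (p : seq int) (L A : set nat) (a : nat) :
  is_pattern p -> strongly_admissible p -> (0 < size p)%N ->
  numerical_semigroup L -> admits p L ->
  minimal_pattern_generators p L A -> A a ->
  numerical_semigroup (L `\ a) /\ admits p (L `\ a).
Proof.
move=> pP p_sadm p_gt0 LP Lp [Agen Amin] Aa.
have adm := p_sadm.1; have [[L0 LD] cofL] := LP.
have AL := pattern_generatorsW Agen.
set G := pattern_hull p (A `\ a).
have Gsub : submonoid G := submonoid_hull p _.
have Gp : admits p G := admits_hull adm.
(* The set [M] below agrees with [G] under [a] and with [L] from [a] on; it admits [p] and contains
   [A], so it is all of [L]. *)
have GL : G `<=` L by apply: hull_sub => // x [/AL].
pose M := G `|` [set x | L x /\ (a <= x)%N].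
have ML : M `<=` L by move=> x [/GL|[]].
have M0 : M 0%N by left; exact: Gsub.1.
have LM : L `<=` M.
  apply: (pattern_generators_sub Agen).
  - split; first (split=> // x y Mx My).
      have [le_a|lt_a] := leqP a (x + y).
        by right; split=> //; apply: LD; apply: ML.
      case: Mx => [Gx|[_ le_ax]]; last by lia.
      case: My => [Gy|[_ le_ay]]; last by lia.
      by left; apply: Gsub.2.
    have [N NL] := finite_setC_natP cofL.
    apply: (@finite_setC_nat _ (maxn a N)) => m.
    rewrite geq_max => /andP[am Nm].
    by right; split=> //; apply: NL.
  - apply/admitsP => // f f_ni Mf.
    have [i|x Lx xE] := (admitsP p L0).1 Lp f f_ni; first exact: ML.
    have := strongly_admissible_ge pP p_sadm p_gt0 f_ni.
    rewrite -xE lez_nat => f0x.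
    have [le_a|lt_a] := leqP a x.
      by exists x => //; right.
    (* All arguments are at most [x < a], so they come from [G]. *)
    have [i|y Gy yE] := (admitsP p Gsub.1).1 Gp f f_ni; last first.
      by exists y; [left | rewrite yE].
    case: (Mf i) => [//|[_]]; rewrite leqNgt.
    by rewrite (leq_ltn_trans _ lt_a) // (leq_trans _ f0x) // f_ni.
  - move=> x Ax; have [->|/eqP xa] := eqVneq x a.
      by right; split=> //; apply: AL.
    by left; apply: sub_hull.
have belowG x : L x -> (x < a)%N -> G x.
  by move=> /LM [//|[_]]; rewrite leqNgt => /negP.
have Ga : ~ G a.
  move=> Ga.
  have AG : A `<=` G.
    move=> x Ax; have [->//|/eqP xa] := eqVneq x a.
    exact: sub_hull.
  have GP : numerical_semigroup G.
    split=> //; apply: sub_finite_set Agen.1.2.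
    by apply: subsetC; apply: generated_sub.
  have GE : G = L.
    by apply/seteqP; split=> //; apply: (pattern_generators_sub Agen).
  have BA : A `\ a = A.
    by apply: Amin; [exact: pattern_generatorsP | move=> x []].
  by move: Aa; rewrite -BA => -[_]; apply.
have a_gt0 : (0 < a)%N.
  by rewrite lt0n; apply/eqP => a0; apply: Ga; rewrite a0; exact: Gsub.1.
have La0 : (L `\ a) 0%N by split=> // a0; move: a_gt0; rewrite -a0.
split.
  split; first (split=> // x y [Lx xa] [Ly ya]).
    split; first exact: LD.
    (* Two nonzero terms with sum [a] are less than [a], so they lie in [G], which would then
       contain [a]. *)
    move=> /= aE; have [x0|x_gt0] := posnP x.
      by apply: ya; rewrite /= -aE x0.
    have [y0|y_gt0] := posnP y; first by apply: xa; rewrite /= -aE y0 addn0.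
    by apply: Ga; rewrite -aE; apply: Gsub.2; apply: belowG => //; lia.
  have [N NL] := finite_setC_natP cofL.
  apply: (@finite_setC_nat _ (maxn a.+1 N)) => m.
  rewrite geq_max => /andP[am Nm].
  by split; [exact: NL | move=> /= ma; rewrite ma ltnn in am].
apply/admitsP => // f f_ni Laf.
have [i|x Lx xE] := (admitsP p L0).1 Lp f f_ni; first exact: (Laf i).1.
exists x => //; split=> //= xa; apply: Ga.
(* If [p] takes the value [a], its arguments are at most [a] and differ from [a]; they lie in [G],
   which again would contain [a]. *)
have := strongly_admissible_ge pP p_sadm p_gt0 f_ni.
rewrite -xE lez_nat xa => f0a.
have [i|y Gy] := (admitsP p Gsub.1).1 Gp f f_ni.
  apply: belowG; first exact: (Laf i).1.
  rewrite ltn_neqAle (leq_trans (f_ni _ _ (leq0n i)) f0a) andbT.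
  by apply/eqP => fia; apply: (Laf i).2.
by rewrite -xE xa => -[<-].
Qed.

Lemma removable_generator (p : seq int) (L A : set nat) (a : nat) :
  pattern_generators p L A -> L a ->
  numerical_semigroup (L `\ a) -> admits p (L `\ a) -> A a.
Proof.
move=> Agen La LaP Lap; apply: contrapT => Aa.
have /(_ a La) [_ []//] : L `<=` L `\ a.
apply: (pattern_generators_sub Agen) => // x Ax.
split; first exact: (pattern_generatorsW Agen).
by move=> /= xa; apply: Aa; rewrite -xa.
Qed.

Theorem proposition32 (p : seq int) (L : set nat)
    (pP : is_pattern p) (p_sadm : strongly_admissible p) (p_prem : premonic p)
    (LP : numerical_semigroup L) (Lp : admits p L) :
  (exists L' : set nat,
      [/\ numerical_semigroup L', admits p L' &
          Posz @` L = (Posz @` L') `|` [set frobenius L']])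
  <->
  (exists a : nat, min_generators p L a /\ frobenius L < a%:Z).
Proof.
have p_gt0 : (0 < size p)%N.
  by case: p_prem => k [/andP[k_gt0 k_le] _]; apply: leq_trans k_le.
have minP : minimal_pattern_generators p L (min_generators p L).
  rewrite /min_generators; case: xgetP => [_ -> //|noA].
  by have [A /noA] := minimal_pattern_generators_ex LP Lp.
split=> [[L' [L'P L'p LE]]|[a [Aa Fa]]].
  (* Membership in [L] makes the Frobenius number of [L'] a natural number, which excludes the
     default value -1. *)
  have [a La aF] : (Posz @` L) (frobenius L') by rewrite LE; right.
  have /esym/frobeniusP [L'a aL'] := aF.
  have L'L x : L' x -> L x.
    move=> L'x; have [y Ly [<-] //] : (Posz @` L) x%:Z.
    by rewrite LE; left; exists x.
  have L'E : L' = L `\ a.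
    apply/seteqP; split=> x.
      move=> L'x; split; first exact: L'L.
      by move=> /= xa; apply: L'a; rewrite -xa.
    move=> [Lx xa]; have : (Posz @` L) x%:Z by exists x.
    by rewrite LE -aF => -[[y L'y [<-]] //|[]].
  exists a; split.
    by apply: (removable_generator minP.1) => //; rewrite -L'E.
  rewrite ltNge; apply/negP => le_aF.
  (* A Frobenius number [n >= a] of [L] would be [a] or exceed the Frobenius number [a] of [L'],
     hence lie in [L]. *)
  case FE : (frobenius L) le_aF => [n|//]; rewrite lez_nat => le_an.
  have [Ln _] := (frobeniusP L n).1 FE.
  apply: Ln; move: le_an; rewrite leq_eqVlt => /predU1P[<- //|/aL'].
  exact: L'L.
have [LaP Lap] := generator_removable pP p_sadm p_gt0 LP Lp minP Aa.
have La : L a := pattern_generatorsW minP.1 Aa.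
have aL := frobenius_lt LP.2 Fa.
exists (L `\ a); split=> //.
have -> : frobenius (L `\ a) = a%:Z.
  apply/frobeniusP; split=> [[_]|m lt_am]; first exact.
  split; first exact/aL/ltnW.
  by move=> /= ma; rewrite ma ltnn in lt_am.
apply/seteqP; split=> [_ [x Lx <-]|_ [[x [Lx _] <-]|->]]; last 2 first.
- by exists x.
- by exists a.
have [->|/eqP xa] := eqVneq x a; first by right.
by left; exists x.
Qed.
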